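(* Let $n\ge1$, $d\ge1$, $m\ge1$, and let $E\subseteq D(d)$ with $\#E\le\binom{m+n-1}{n}$ (i.e. the triple $(n,E,(m))$ is over- or well-determined). For some $1\le k\leq m$, let $H_1,\ldots,H_k$ be distinct dimension-$n$ linear subspaces of $\mathbb Q^{n+1}$ which intersect $\tilde D(d)$ in parallel (affine) hyperplanes of $\tilde D(d)$. Let $E'=E\cap(H_1\cup\cdots\cup H_k)$. 1. Suppose $$\#E'>\sum_{i=1}^k\binom{m-i+n-1}{n-1}=\binom{m+n-1}{n}-\binom{m-k+n-1}{n}.$$ Then $(n,E,(m))$ is special. 2. Suppose that $E=E'$, and that for $i=1,\ldots,k$ $$\#(E\cap H_i)\leq\binom{m-i+n-1}{n-1}.$$ If for each $i=1,\ldots,k$, $$\dim W^{H_i}(m-i,E\cap H_i)=\binom{m-i+n-1}{n-1}-\#(E\cap H_i),$$ then $(n,E,(m))$ is non-special.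
   Context: $\mathbb K$ is a field of characteristic $0$, and $\mathbb N=\{0,1,2,\ldots\}$. $D(d)=\{\mathbf a\in\mathbb N^{n+1}: a_0+\cdots+a_n=d\}$, and $\tilde D(d)=\{\mathbf a\in\mathbb Q^{n+1}: a_0+\cdots+a_n=d\}$ is the hyperplane containing it. For $E\subseteq D(d)$, $V^n_E(m)$ is the $\mathbb K$-vector space of polynomials $f$ in the $\mathbb K$-span of the monomials $X_0^{a_0}\cdots X_n^{a_n}$, $\mathbf a\in E$, that vanish with multiplicity at least $m$ at a general point $p\in\mathbb{KP}^n$ (its dimension is the constant value taken on a nonempty Zariski-open set of $p$). The triple $(n,E,(m))$ is non-special if $\dim V^n_E(m)=\max\{\#E-\binom{m+n-1}{n},0\}$, and special otherwise. For a linear subspace $S\subseteq\mathbb Q^{n+1}$, $e\ge0$ and a set $F\subseteq D(d)\cap S$, $W^S(e,F)$ is the $\mathbb Q$-vector space of homogeneous polynomial functions of degree $e$ on $S$ (sections of $\mathcal O_{\mathbb P S}(e)$, where $\mathbb PS$ is the space of lines in $S$ through the origin) that vanish at every point of $F$. *)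

(* Defs.v *)
From HB Require Import structures.
From mathcomp Require Import all_boot all_order all_algebra.
From mathcomp Require Import finmap mpoly functions.

Set Implicit Arguments.
Unset Strict Implicit.
Unset Printing Implicit Defensive.

Import GRing.Theory.
Local Open Scope ring_scope.

(* The ambient modules used below ({mpoly K[n.+1]} and function spaces) are
   infinite-dimensional, so that \dim is not available: [has_dim P k] says that
   the subset P of V is a subspace with a basis of k elements.               *)
Definition has_dim (K : fieldType) (V : lmodType K) (P : V -> Prop) (k : nat)
    : Prop :=
  exists b : 'I_k -> V,
    (forall c : 'I_k -> K, \sum_i c i *: b i = 0 -> forall i, c i = 0) /\
    (forall v : V, P v <-> exists c : 'I_k -> K, v = \sum_i c i *: b i).

(* A point of the projective n-space is given by a representative p != 0. For
   homogeneous f, the multiplicity of f at the projective point is the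
   multiplicity of f at any representative; in characteristic 0 it is at least
   m iff all the partial derivatives of order less than m vanish there.      *)
Definition vanishes_with_mult (K : fieldType) (n : nat)
    (f : {mpoly K[n.+1]}) (p : 'rV[K]_n.+1) (m : nat) : Prop :=
  forall b : 'X_{1..n.+1}, (mdeg b < m)%N -> (f^`M[b]).@[p 0] = 0.

Definition VE_at (K : fieldType) (n : nat) (E : {fset 'X_{1..n.+1}}) (m : nat)
    (p : 'rV[K]_n.+1) (f : {mpoly K[n.+1]}) : Prop :=
  (exists c : 'X_{1..n.+1} -> K, f = \sum_(a <- E) c a *: 'X_[a]) /\
  vanishes_with_mult f p m.

(* Complements of the common zero loci of families G of forms.               *)
Definition zariski_open_proj (K : fieldType) (n : nat)
    (U : 'rV[K]_n.+1 -> Prop) : Prop :=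
  exists G : {mpoly K[n.+1]} -> Prop,
    (forall g, G g -> exists e, g \is e.-homog) /\
    (forall p, U p <-> p != 0 /\ exists g, G g /\ g.@[p 0] != 0).

Definition general_dim (K : fieldType) (n : nat) (E : {fset 'X_{1..n.+1}})
    (m k : nat) : Prop :=
  exists U : 'rV[K]_n.+1 -> Prop,
    [/\ zariski_open_proj U,
        exists p, U p
      & forall p, U p -> has_dim (VE_at E m p) k].

(* The truncated subtraction of nat is the max with 0.                       *)
Definition nonspecial (K : fieldType) (n : nat) (E : {fset 'X_{1..n.+1}})
    (m : nat) : Prop :=
  general_dim K E m (#|` E| - 'C(m + n - 1, n))%N.

Definition special (K : fieldType) (n : nat) (E : {fset 'X_{1..n.+1}})
    (m : nat) : Prop :=
  ~ nonspecial K E m.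

Definition mpoint (n : nat) (a : 'X_{1..n.+1}) : 'rV[rat]_n.+1 :=
  \row_i (a i)%:R.

Definition Dtilde (n d : nat) (x : 'rV[rat]_n.+1) : Prop :=
  \sum_i x 0 i = d%:R.

Definition affine_with_direction (n : nat) (A : 'rV[rat]_n.+1 -> Prop)
    (L : {vspace 'rV[rat]_n.+1}) : Prop :=
  exists b, A b /\ forall x, A x <-> x - b \in L.

(* Dtilde d has dimension n, so its affine hyperplanes have dimension n - 1;
   being parallel means sharing the direction L. In particular no H i is the
   linear hyperplane of equation x_0 + ... + x_n = 0 when 0 < d.             *)
Definition meet_Dtilde_in_parallel_hyperplanes (n d k : nat)
    (H : 'I_k -> {vspace 'rV[rat]_n.+1}) : Prop :=
  exists L : {vspace 'rV[rat]_n.+1},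
    (\dim L).+1 = n /\
    forall i, affine_with_direction (fun x => x \in H i /\ Dtilde d x) L.

(* Homogeneous polynomial functions of degree e on S are the restrictions to S
   of the forms of degree e on the ambient space.                            *)
Definition WS (n : nat) (S : {vspace 'rV[rat]_n.+1}) (e : nat)
    (F : {fset 'X_{1..n.+1}}) (phi : subvs_of S -> rat^o) : Prop :=
  (exists g : {mpoly rat[n.+1]},
      g \is e.-homog /\ forall x : subvs_of S, phi x = g.@[vsval x 0]) /\
  (forall (a : 'X_{1..n.+1}) (x : subvs_of S),
      a \in F -> vsval x = mpoint a -> phi x = 0).

(* Main.v *)
Require Import Defs.
From HB Require Import structures.
From mathcomp Require Import all_boot all_order all_algebra.
From mathcomp Require Import finmap mpoly functions.

Set Implicit Arguments.
Unset Strict Implicit.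
Unset Printing Implicit Defensive.

Import GRing.Theory.
Local Open Scope ring_scope.

(** Write f = sum_(a in E) c_a X^a and let p be a point with no zero coordinate.
    Multiplying the derivative of f of order b at p by p^b gives
    sum_a gamma_a (a)_b, with gamma_a = c_a p^a and (a)_b a product of falling
    factorials in the coordinates of a. So f vanishes to order m at p iff the
    weights gamma kill every polynomial of degree < m evaluated on E; as E lies
    in the hyperplane x_0 + ... + x_n = d with d != 0 in K, this amounts to
    killing every form of degree m - 1 ([vanishing_forms]). Hence the general
    dimension is computed on the torus, and it is 0 iff the evaluation of forms
    of degree m - 1 on E is onto. This question has rational data and is
    settled over the rationals, with ell_i a linear equation of H_i.

    Special case: multiples of the product of the ell_i vanish on E', which
    bounds the rank of the evaluation on E' strictly below #|E'|; a linear
    relation between the evaluations at E' is a nonzero gamma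
    ([dependency_on_zero_locus], [special_if_dependency]).

    Non-special case: the dimension of W^{H_i} says that forms of degree m - i
    take arbitrary values on E n H_i ([interpolation_on_subspace]). Since the
    H_i are distinct and cut parallel hyperplanes, the sets E n H_i are disjoint
    ([parallel_hyperplanes_disjoint]), so a form of degree m - 1 with
    prescribed values on E is built as a sum of terms ell_1 ... ell_{i-1} g_i,
    where g_i corrects the values on E n H_i without disturbing the previous
    ones ([interpolation_by_peeling], [nonspecial_if_interpolation]). *)

(** * Fields of characteristic zero *)

Section CharacteristicZero.
Variables (K : fieldType) (charK0 : [pchar K] =i pred0).

Lemma natr_inj_pchar0 : injective (fun i : nat => i%:R : K).
Proof.
have natr_eq0 : forall i : nat, (i%:R == 0 :> K) = (i == 0)%N by apply/pcharf0P.
move=> i j /eqP; wlog leij : i j / (i <= j)%N => [hw|].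
  by case/orP: (leq_total i j) => [/hw //|/hw h]; rewrite eq_sym => /h.
rewrite eq_sym -subr_eq0 -natrB // natr_eq0 => /eqP/eqP.
by rewrite subn_eq0 => leji; apply/eqP; rewrite eqn_leq leij.
Qed.

Lemma intr_eq0_pchar0 (z : int) : (z%:~R == 0 :> K) = (z == 0).
Proof.
have natr_eq0 : forall i : nat, (i%:R == 0 :> K) = (i == 0)%N by apply/pcharf0P.
by case: z => z; rewrite ?NegzE ?mulrNz ?oppr_eq0 -?pmulrn natr_eq0.
Qed.

(** [ratr] is computed on reduced fractions; in characteristic 0 any fraction
    does, and this is what makes [ratr] a morphism below. *)
Lemma ratr_frac_pchar0 (z w : int) : w != 0 ->
  ratr (z%:~R / w%:~R) = z%:~R / w%:~R :> K.
Proof.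
move=> nzw; rewrite /ratr; set x : rat := _ / _.
have cross : numq x * w = z * denq x.
  apply: (@intr_inj rat); rewrite !rmorphM /= numqE mulrAC.
  by rewrite /x divfK // intr_eq0.
apply/eqP; rewrite eqr_div ?intr_eq0_pchar0 ?denq_eq0 //.
by rewrite -!rmorphM /= cross.
Qed.

Lemma rat_embedding : inhabited {rmorphism rat -> K}.
Proof.
have nz x : (denq x)%:~R != 0 :> K by rewrite intr_eq0_pchar0 denq_eq0.
have nzQ x : (denq x)%:~R != 0 :> rat by rewrite intr_eq0 denq_eq0.
have fB : zmod_morphism (@ratr K).
  move=> x y; rewrite -{1}[x]divq_num_den -{1}[y]divq_num_den -mulNr.
  rewrite -[- (_%:~R)]rmorphN /= addf_div // -!rmorphM -rmorphD /=.
  rewrite ratr_frac_pchar0; last by rewrite mulf_neq0 ?denq_eq0.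
  by rewrite rmorphD !rmorphM rmorphN /= /ratr -mulNr addf_div.
have fM : monoid_morphism (@ratr K).
  split=> [|x y]; first by rewrite /ratr divr1.
  rewrite -{1}[x]divq_num_den -{1}[y]divq_num_den mulf_div -!rmorphM /=.
  by rewrite ratr_frac_pchar0 ?mulf_neq0 ?denq_eq0 // !rmorphM /= /ratr mulf_div.
pose fBm := GRing.isZmodMorphism.Build rat K (@ratr K) fB.
pose fMm := GRing.isMonoidMorphism.Build rat K (@ratr K) fM.
by constructor; exact: (HB.pack (@ratr K) fBm fMm).
Qed.

Lemma poly_nonroot (q : {poly K}) : q != 0 -> exists x, q.[x] != 0.
Proof.
move=> nzq; pose rs := [seq i%:R : K | i <- iota 0 (size q)].
have uniq_rs : uniq rs.
  by rewrite map_inj_uniq ?iota_uniq //; exact: natr_inj_pchar0.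
have /allPn[x _ nrx] : ~~ all (root q) rs.
  apply/negP => /(max_poly_roots nzq)/(_ uniq_rs).
  by rewrite size_map size_iota ltnn.
by exists x.
Qed.

Lemma digits_inj (n D : nat) (f g : 'I_n -> nat) :
  (forall i, f i < D)%N -> (forall i, g i < D)%N ->
  (\sum_i f i * D ^ i = \sum_i g i * D ^ i)%N -> f =1 g.
Proof.
elim: n f g => [|n IHn] f g ltf ltg; first by move=> _ [].
have D_gt0 : (0 < D)%N by apply: leq_ltn_trans (ltf ord0).
have split_low (h : 'I_n.+1 -> nat) : (\sum_i h i * D ^ i
    = (\sum_(i < n) h (lift ord0 i) * D ^ i) * D + h ord0)%N.
  rewrite big_ord_recl muln1 addnC big_distrl /=; congr (_ + _)%N.
  by apply: eq_bigr => i _; rewrite -mulnA -expnSr.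
rewrite !split_low => eqfg.
have eq0 : f ord0 = g ord0.
  by have := congr1 (modn^~ D) eqfg; rewrite !modnMDl !modn_small.
have := congr1 (divn^~ D) eqfg.
rewrite !divnMDl // !divn_small // !addn0 => /IHn eqS i.
by case: (unliftP ord0 i) => [j|] ->; rewrite ?eq0 // eqS.
Qed.

(** Kronecker substitution X_i := x^(D^i): when D exceeds all the exponents
    of p, distinct monomials go to distinct powers of x, so a nonzero p yields a
    nonzero polynomial in one variable. *)
Lemma mpoly_nonroot (n : nat) (p : {mpoly K[n]}) :
  p != 0 -> exists v, p.@[v] != 0.
Proof.
move=> nzp; pose D := msize p.
pose code (a : 'X_{1..n}) := (\sum_i a i * D ^ i)%N.
pose q : {poly K} := \sum_(a <- msupp p) p@_a *: 'X^(code a).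
have digit_lt a i : a \in msupp p -> (a i < D)%N.
  move/msize_mdeg_lt; apply: leq_ltn_trans.
  by rewrite mdegE (bigD1 i) //= leq_addr.
have [x qx] : exists x, q.[x] != 0.
  apply: poly_nonroot; apply/eqP => q0.
  have [a pa] : exists a, a \in msupp p.
    by exists (mlead p); rewrite mlead_supp.
  have: q`_(code a) = 0 by rewrite q0 coef0.
  rewrite coef_sum (bigD1_seq a) //= coefZ coefXn eqxx mulr1.
  rewrite big_seq_cond big1 => [/eqP|b /andP[pb neqb]].
    by rewrite addr0 mcoeff_eq0 pa.
  rewrite coefZ coefXn; case: eqP => [eqab|_]; last by rewrite mulr0.
  case/eqP: neqb; apply/mnmP; apply: (@digits_inj _ D) => // [i|i]; exact: digit_lt.
exists (fun i => x ^+ (D ^ i)); apply: contraNneq qx => p0.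
apply/eqP; rewrite -[RHS]p0 mevalE horner_sum; apply: eq_bigr => a _.
rewrite hornerZ hornerXn /code expr_sum; congr (_ * _).
by apply: eq_bigr => i _; rewrite mulnC exprM.
Qed.

Lemma mpoly_ext (n : nat) (p q : {mpoly K[n]}) :
  (forall v, p.@[v] = q.@[v]) -> p = q.
Proof.
move=> pq; apply/eqP; rewrite -subr_eq0; apply: contraT => /mpoly_nonroot[v].
by rewrite mevalB pq subrr eqxx.
Qed.

End CharacteristicZero.

(** * Linear algebra *)

(** A linear map injective on A and sending it into P bounds \dim A by the
    dimension of P. It is used to read an upper bound on a kernel from a
    [has_dim] hypothesis in an infinite-dimensional space. *)
Lemma dim_le_has_dim (K : fieldType) (U : vectType K) (V : lmodType K)
    (P : V -> Prop) (k : nat) (A : {vspace U}) (f : {linear U -> V}) :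
  has_dim P k -> (forall u, u \in A -> P (f u)) ->
  (forall u, u \in A -> f u = 0 -> u = 0) -> (\dim A <= k)%N.
Proof.
case=> b [_ spanb] fP finj; pose e := vbasis A.
have /fin_all_exists[c fe] (i : 'I_(\dim A)) :
    exists c : 'I_k -> K, f e`_i = \sum_j c j *: b j.
  by apply/spanb/fP/vbasis_mem/mem_nth; rewrite size_tuple.
rewrite leqNgt; apply/negP => ltkA.
pose C := \matrix_(i < \dim A, j < k) c i j.
have /rowV0Pn[v /sub_kermxP vC /eqP[]] : kermx C != 0.
  rewrite kermx_eq0; apply/negP => /eqP rC.
  by have:= rank_leq_col C; rewrite rC leqNgt ltkA.
have: \sum_i v 0 i *: e`_i = 0.
  apply: finj.
    by rewrite rpred_sum // => i _; rewrite rpredZ // vbasis_mem // mem_nth ?size_tuple.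
  rewrite linear_sum /=.
  under eq_bigr => i _ do rewrite linearZ fe /= scaler_sumr.
  rewrite exchange_big big1 // => j _.
  under eq_bigr => i _ do rewrite scalerA.
  rewrite -scaler_suml; have /rowP/(_ j) := vC.
  by rewrite !mxE; under eq_bigr => i _ do rewrite mxE; move=> ->; rewrite scale0r.
by move/freeP: (basis_free (vbasisP A)) => h /h v0; apply/rowP => i; rewrite mxE v0.
Qed.

Lemma annihilator_exists (K : fieldType) (s : nat) (U : {vspace 'rV[K]_s}) :
  (\dim U < s)%N ->
  exists2 c : 'cV_s, c != 0 & forall u, u \in U -> u *m c = 0.
Proof.
move=> ltUs; pose M := \matrix_(i < \dim U) (vbasis U)`_i.
have /rowV0Pn[v /sub_kermxP vM nzv] : kermx M^T != 0.
  rewrite kermx_eq0; apply/negP => /eqP rM.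
  by have:= rank_leq_col M^T; rewrite rM leqNgt ltUs.
have Mv : M *m v^T = 0 by rewrite -[M]trmxK -trmx_mul vM trmx0.
exists v^T => [|u /coord_vbasis ->].
  by apply: contraNneq nzv => v0; rewrite -[v]trmxK v0 trmx0.
rewrite mulmx_suml big1 // => i _; rewrite -scalemxAl.
have -> : (vbasis U)`_i = row i M by rewrite rowK.
by rewrite -row_mul Mv row0 scaler0.
Qed.

Lemma hyperplane_equation (K : fieldType) (s : nat) (U : {vspace 'rV[K]_s}) :
  (\dim U).+1 = s ->
  exists2 c : 'cV_s, c != 0 & forall u, (u \in U) = (u *m c == 0).
Proof.
move=> dimU; have [|c nzc cU] := annihilator_exists (U := U).
  by rewrite dimU.
exists c => // u; apply/idP/eqP => [/cU //|uc]; apply: contraT => uU.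
have full : (U + <[u]>)%VS = fullv.
  apply/eqP; rewrite eqEdim subvf dimvf dim_matrix mul1r -[X in (X <= _)%N]dimU.
  rewrite dimv_disjoint_sum; last first.
    apply/eqP; rewrite -subv0; apply/subvP => w /memv_capP[wU /vlineP[a w_eq]].
    rewrite memv0 w_eq; have [->|nza] := eqVneq a 0; first by rewrite scale0r.
    by case/negP: uU; rewrite -[u](scalerK nza) rpredZ // -w_eq.
  rewrite dim_vline -addn1 leq_add2l lt0b; apply: contraNneq uU => ->.
  by rewrite mem0v.
case/eqP: nzc; apply/colP => i.
have: delta_mx 0 i \in (U + <[u]>)%VS by rewrite full memvf.
case/memv_addP => a aU [b /vlineP[l b_eq] e_eq].
have: delta_mx (0 : 'I_1) i *m c = 0.
  by rewrite e_eq mulmxDl cU // b_eq -scalemxAl uc scaler0 addr0.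
by move/matrixP/(_ 0 0); rewrite -rowE !mxE.
Qed.

(** * Forms and their values at rational points *)

Lemma dhomog_big_prod (R : comNzRingType) (n : nat) (I : Type) (r : seq I)
    (P : pred I) (e : I -> nat) (f : I -> {mpoly R[n]}) :
  (forall i, P i -> f i \is (e i).-homog) ->
  \prod_(i <- r | P i) f i \is (\sum_(i <- r | P i) e i).-homog.
Proof.
move=> fP; apply: (big_rec2 (fun p d => p \is d.-homog)); first exact: dhomog1.
by move=> i d p Pi; apply: dhomogM; apply: fP.
Qed.

Lemma dhomog_comp (R : comNzRingType) (n k e : nat) (p : {mpoly R[n]})
    (y : 'I_n -> {mpoly R[k]}) :
  p \is e.-homog -> (forall i, y i \is 1.-homog) ->
  p \mPo [tuple y i | i < n] \is e.-homog.
Proof.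
move=> /dhomogP pP yP; rewrite comp_mpolyEX big_seq rpred_sum // => a /pP dega.
change (mdeg a = e) in dega.
rewrite rpredZ // comp_mpolyX.
have -> : e = (\sum_i 1 * a i)%N.
  by rewrite -dega mdegE; apply: eq_bigr => i _; rewrite mul1n.
by apply: dhomog_big_prod => i _; apply: dhomogMn; rewrite tnth_mktuple.
Qed.

Section LinearForms.
Variables (R : fieldType) (n : nat).

Definition linear_form (c : 'cV[R]_n) : {mpoly R[n]} := \sum_i c i 0 *: 'X_i.

Lemma linear_form_homog c : linear_form c \is 1.-homog.
Proof.
by rewrite rpred_sum // => i _; rewrite rpredZ // dhomogX; apply/eqP/mdeg1.
Qed.

Lemma meval_linear_form c (x : 'rV_n) : (linear_form c).@[x 0] = (x *m c) 0 0.
Proof.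
rewrite mxE raddf_sum /=; apply: eq_bigr => i _.
by rewrite mevalZ mevalXU mulrC.
Qed.

Lemma linear_form_neq0 c : c != 0 -> linear_form c != 0.
Proof.
apply: contraNneq => c0; apply/eqP/colP => i.
have := meval_linear_form c (delta_mx 0 i).
by rewrite c0 meval0 -rowE !mxE => <-.
Qed.

End LinearForms.

(** Coordinate functions of S are restrictions of linear forms y_i of the
    ambient space; substituting them identifies forms in q variables with
    forms on S. *)
Lemma coordinates_on_subspace (n q : nat) (S : {vspace 'rV[rat]_n}) :
  \dim S = q ->
  exists y : 'I_q -> {mpoly rat[n]}, (forall i, y i \is 1.-homog) /\
  forall v : 'I_q -> rat, exists2 x, x \in S & forall i, (y i).@[x 0] = v i.
Proof.
move=> <-.
exists (fun i => linear_form (\col_j coord (vbasis S) i (delta_mx 0 j))).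
split=> [i|v]; first exact: linear_form_homog.
have coordE i (x : 'rV_n) : (linear_form
    (\col_j coord (vbasis S) i (delta_mx 0 j))).@[x 0] = coord (vbasis S) i x.
  rewrite meval_linear_form mxE {2}[x]row_sum_delta linear_sum /=.
  by apply: eq_bigr => j _; rewrite linearZ mxE.
exists (\sum_i v i *: (vbasis S)`_i) => [|i].
  by rewrite rpred_sum // => i _; rewrite rpredZ // vbasis_mem // mem_nth ?size_tuple.
by rewrite coordE coord_sum_free // (basis_free (vbasisP S)).
Qed.

(** The forms y_i are either coordinates of a subspace, to evaluate forms on
    that subspace, or the ambient variables, to evaluate ambient forms. *)
Definition eval_at (n N s : nat) (a : 'I_s -> 'X_{1..N.+1})
    (y : 'I_n -> {mpoly rat[N.+1]}) (e : nat) (p : dhomog n rat e) :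
    'rV[rat]_s :=
  \row_j ((p : {mpoly rat[n]}) \mPo [tuple y i | i < n]).@[mpoint (a j) 0].

Lemma eval_at_is_linear n N s a y e : linear (@eval_at n N s a y e).
Proof.
move=> c p q; apply/rowP => j.
by rewrite !mxE /= comp_mpolyD comp_mpolyZ mevalD mevalZ.
Qed.

HB.instance Definition _ n N s a y e :=
  GRing.isLinear.Build rat (dhomog n rat e) 'rV[rat]_s _ (@eval_at n N s a y e)
    (@eval_at_is_linear n N s a y e).

Definition restrict_to (n N : nat) (S : {vspace 'rV[rat]_N.+1})
    (y : 'I_n -> {mpoly rat[N.+1]}) (e : nat) (p : dhomog n rat e) :
    subvs_of S -> rat^o :=
  fun x => ((p : {mpoly rat[n]}) \mPo [tuple y i | i < n]).@[vsval x 0].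

Lemma restrict_to_is_linear n N S y e : linear (@restrict_to n N S y e).
Proof.
move=> c p q; apply: boolp.funext => x.
by rewrite /restrict_to /= comp_mpolyD comp_mpolyZ mevalD mevalZ.
Qed.

HB.instance Definition _ n N S y e :=
  GRing.isLinear.Build rat (dhomog n rat e) (subvs_of S -> rat^o) _
    (@restrict_to n N S y e) (@restrict_to_is_linear n N S y e).

(** The forms of degree e on S have dimension 'C(e + n - 1, n - 1), and the
    kernel of their evaluation on F embeds into W^S(e, F); the assumed
    dimension of the latter therefore forces the rank of the evaluation to be
    #|F|, i.e. every function on F is the restriction of a form. *)
Lemma interpolation_on_subspace (N n e : nat) (S : {vspace 'rV[rat]_N.+1})
    (F : {fset 'X_{1..N.+1}}) :
  (0 < n)%N -> \dim S = n -> (forall a, a \in F -> mpoint a \in S) ->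
  (#|` F| <= 'C(e + n - 1, n - 1))%N ->
  has_dim (WS (S := S) e F) ('C(e + n - 1, n - 1) - #|` F|)%N ->
  forall h : 'X_{1..N.+1} -> rat, exists2 g : {mpoly rat[N.+1]},
    g \is e.-homog & forall a, a \in F -> g.@[mpoint a 0] = h a.
Proof.
case: n => // n _ dimS FS leF dimW h.
have binE : 'C(e + n.+1 - 1, n.+1 - 1) = 'C(e + n, e).
  by rewrite addnS !subn1 /= -[RHS]bin_sub ?leq_addr // addKn.
rewrite binE in leF dimW.
have [y [y_homog y_surj]] := coordinates_on_subspace dimS.
pose s := size F; pose t := tnth (in_tuple F).
pose ev := linfun (@eval_at n.+1 N s t y e).
have evE (p : dhomog n.+1 rat e) j :
    ev p 0 j = (p \mPo [tuple y i | i < n.+1]).@[mpoint (t j) 0].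
  by rewrite lfunE mxE.
have dim_forms : \dim {:dhomog n.+1 rat e} = 'C(e + n, e) by rewrite dimvf.
have dim_ker : (\dim (lker ev) <= 'C(e + n, e) - #|` F|)%N.
  apply: (dim_le_has_dim (f := @restrict_to n.+1 N S y e)) dimW _ _ => p.
    rewrite memv_ker => /eqP/rowP evp; split.
      exists (p \mPo [tuple y i | i < n.+1]); split=> //.
      exact: dhomog_comp (dhomog_is_dhomog p) y_homog.
    move=> a x /seq_tnthP[j aj] xa.
    by have := evp j; rewrite evE mxE /t -aj -xa.
  move=> _ p0; apply/val_inj.
  apply: (mpoly_ext (Num.Theory.pchar_num _)) => v /=.
  have [x xS yx] := y_surj v.
  have : restrict_to y p (vsproj S x) = 0 by rewrite p0.
  rewrite /restrict_to vsprojK // comp_mpoly_meval meval0 => <-.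
  by apply: meval_eq => i; rewrite tnth_mktuple yx.
have full : limg ev = fullv.
  apply/eqP; rewrite eqEdim subvf dimvf dim_matrix mul1r.
  have := limg_ker_dim ev fullv; rewrite capfv dim_forms => dims.
  by rewrite -(leq_add2l (\dim (lker ev))) dims -(subnK leF) leq_add2r.
have /memv_imgP[p _ p_eq] : \row_j h (t j) \in limg ev by rewrite full memvf.
exists (p \mPo [tuple y i | i < n.+1]).
  exact: dhomog_comp (dhomog_is_dhomog p) y_homog.
by move=> a /seq_tnthP[j ->]; rewrite -evE -p_eq mxE.
Qed.

(** Forms of degree D divisible by L vanish on F. They make up a space of
    dimension 'C(D - k + N, D - k), or 0 when D < k, so under the bound on #|F|
    the evaluation of forms of degree D on F is not onto: its image is killed
    by a nonzero functional gamma. *)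
Lemma dependency_on_zero_locus (N D k : nat) (F : {fset 'X_{1..N.+1}})
    (L : {mpoly rat[N.+1]}) :
  L != 0 -> L \is k.-homog -> (forall a, a \in F -> L.@[mpoint a 0] = 0) ->
  ('C(D + N, D) < #|` F| + (if (k <= D)%N then 'C(D - k + N, D - k) else 0))%N ->
  exists gamma : 'X_{1..N.+1} -> rat,
    (exists2 a, a \in F & gamma a != 0) /\
    forall g, g \is D.-homog -> \sum_(a <- F) gamma a * g.@[mpoint a 0] = 0.
Proof.
move=> nzL homL LF ltF.
pose s := size F; pose t := tnth (in_tuple F).
pose ev := linfun (@eval_at N.+1 N s t (fun i => 'X_i) D).
have evE (p : dhomog N.+1 rat D) j :
    ev p 0 j = (p : {mpoly rat[N.+1]}).@[mpoint (t j) 0].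
  rewrite lfunE mxE comp_mpoly_meval; apply: meval_eq => i.
  by rewrite tnth_mktuple mevalXU.
have dim_forms : \dim {:dhomog N.+1 rat D} = 'C(D + N, D) by rewrite dimvf.
have dim_ker :
    ((if (k <= D)%N then 'C(D - k + N, D - k) else 0) <= \dim (lker ev))%N.
  case: (leqP k D) => [lekD|//].
  have LP (p : dhomog N.+1 rat (D - k)) : L * p \is D.-homog.
    by rewrite -[X in X.-homog](subnKC lekD) dhomogM // dhomog_is_dhomog.
  pose mul p := DHomog (LP p).
  have mul_lin : linear mul.
    by move=> c p q; apply/val_inj; rewrite /= mulrDr scalerAr.
  pose mulLM := GRing.isLinear.Build rat _ _ _ mul mul_lin.
  pose mulL : {linear dhomog N.+1 rat (D - k) -> dhomog N.+1 rat D} :=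
    HB.pack mul mulLM.
  have mulE p : linfun mulL p = L * p :> {mpoly rat[N.+1]} by rewrite lfunE.
  have ker0 : lker (linfun mulL) = 0%VS.
    apply/eqP; rewrite -subv0; apply/subvP => p.
    rewrite memv_ker memv0 => /eqP p0.
    apply/eqP/val_inj => /=; move: (mulE p); rewrite p0 /= => /esym/eqP.
    by rewrite mulf_eq0 (negPf nzL) => /eqP.
  have := limg_ker_dim (linfun mulL) fullv.
  rewrite ker0 capv0 dimv0 add0n.
  have -> : \dim {:dhomog N.+1 rat (D - k)} = 'C(D - k + N, D - k).
    by rewrite dimvf.
  move=> <-; apply: dimvS.
  apply/subvP => _ /memv_imgP[p _ ->]; rewrite memv_ker; apply/eqP/rowP => j.
  by rewrite evE mulE mevalM LF ?mul0r ?mxE // mem_tnth.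
have [c nzc cann] : exists2 c : 'cV_s, c != 0 & forall u, u \in limg ev -> u *m c = 0.
  apply: annihilator_exists.
  have := limg_ker_dim ev fullv; rewrite capfv dim_forms => dims.
  rewrite -(ltn_add2l (\dim (lker ev))) dims; apply: leq_trans ltF _.
  by rewrite addnC leq_add2r.
pose gamma a := if insub (index a F) is Some j then c j 0 else 0.
have gammaE j : gamma (t j) = c j 0.
  rewrite /gamma /t (tnth_nth 0%MM) /= index_uniq ?fset_uniq //.
  rewrite insubT //= => lt_j.
  by congr (c _ 0); apply: val_inj.
exists gamma; split.
  have /existsP[j nzj] : [exists j, c j 0 != 0].
    apply: contraNT nzc => /existsPn all0; apply/eqP/colP => j.
    by rewrite mxE; apply/eqP; rewrite -[_ == _]negbK all0.
  by exists (t j); rewrite ?gammaE // mem_tnth.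
move=> g homg; have := cann (ev (DHomog homg)) (memv_img _ (memvf _)).
move/matrixP/(_ 0 0); rewrite !mxE; apply: etrans.
rewrite (big_tnth _ _ (enum_fset F)); apply: eq_bigr => j _.
by rewrite evE gammaE mulrC.
Qed.

(** * The torus is dense *)

Definition in_torus (K : fieldType) (n : nat) (p : 'rV[K]_n.+1) : Prop :=
  forall i, p 0 i != 0.

Lemma torus_monomial_neq0 (K : fieldType) (n : nat) (p : 'rV[K]_n.+1) a :
  in_torus p -> 'X_[a].@[p 0] != 0.
Proof.
move=> nzp; rewrite mevalX; apply/prodf_neq0 => i _; apply: expf_neq0.
exact: nzp.
Qed.

Lemma torus_open (K : fieldType) (n : nat) : zariski_open_proj (@in_torus K n).
Proof.
exists (eq (\prod_i 'X_i)); split=> [_ <-|p].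
  exists (\sum_(i < n.+1) 1)%N; apply: dhomog_big_prod => i _.
  by rewrite dhomogX; apply/eqP/mdeg1.
have evalE : (\prod_i 'X_i : {mpoly K[n.+1]}).@[p 0] = \prod_i p 0 i.
  by rewrite rmorph_prod; apply: eq_bigr => i _; rewrite /= mevalXU.
split=> [nzp|[_ [_ [<-]]]]; last first.
  by rewrite evalE => /prodf_neq0 nzp i; apply: nzp.
split; first by apply: contraNneq (nzp 0) => ->; rewrite mxE.
exists (\prod_i 'X_i); split=> //; rewrite evalE.
by apply/prodf_neq0 => i _; apply: nzp.
Qed.

Lemma open_meets_torus (K : fieldType) (charK0 : [pchar K] =i pred0) (n : nat)
    (U : 'rV[K]_n.+1 -> Prop) :
  zariski_open_proj U -> (exists p, U p) -> exists2 p, U p & in_torus p.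
Proof.
case=> G [_ UG] [p0 /UG[_ [g [Gg gp0]]]].
have nzg : g * \prod_i 'X_i != 0.
  rewrite mulf_neq0 //; first by apply: contraNneq gp0 => ->; rewrite meval0.
  apply/prodf_neq0 => i _; rewrite -msupp_eq0 msuppX //.
have [v] := mpoly_nonroot charK0 nzg.
rewrite mevalM rmorph_prod mulf_eq0 negb_or => /andP[gv /prodf_neq0 nzv].
have v_torus : in_torus (\row_i v i).
  by move=> i; have := nzv i isT; rewrite /= mevalXU mxE.
exists (\row_i v i) => //; apply/UG; split.
  by apply: contraNneq (v_torus 0) => ->; rewrite mxE.
by exists g; split=> //; rewrite (meval_eq (v2 := v)) // => i; rewrite mxE.
Qed.

(** * Vanishing order at a torus point and moments *)

Lemma mnm_peel (n e : nat) (b : 'X_{1..n}) : mdeg b = e.+1 ->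
  exists i b', b = (b' + U_(i))%MM /\ mdeg b' = e.
Proof.
move=> degb; have [i bi] : exists i, b i != 0%N.
  apply/existsP; apply: contraT => /existsPn all0.
  suff: mdeg b = 0%N by rewrite degb.
  by rewrite mdegE big1 // => i _; apply/eqP; rewrite -[_ == _]negbK all0.
have bE : (b - U_(i) + U_(i))%MM = b.
  by apply: submK; apply/mnm_lepP => j; rewrite mnm1E; case: eqP => // <-; rewrite lt0n.
exists i, (b - U_(i))%MM; split=> //.
by have := congr1 mdeg bE; rewrite mdegD mdeg1 degb addn1 => -[].
Qed.

Section Moments.
Variables (K : fieldType) (n : nat) (E : {fset 'X_{1..n.+1}}).
Variable gamma : 'X_{1..n.+1} -> K.
Implicit Types a b c : 'X_{1..n.+1}.

Definition power_at a b : K := \prod_i (a i)%:R ^+ b i.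
Definition ffact_at a b : K := (\prod_i (a i) ^_ (b i))%:R.
(** The monomial basis and the falling factorial basis are mixed in one family,
    so that moving one factor from c to b ([moment_exchange]) compares the two
    triangularly. *)
Definition moment b c : K :=
  \sum_(a <- E) gamma a * (power_at a b * ffact_at a c).

Lemma power_atDU a b i : power_at a (b + U_(i))%MM = power_at a b * (a i)%:R.
Proof.
rewrite /power_at (bigD1 i) //= [in RHS](bigD1 i) //= mnmDE mnm1E eqxx addn1.
rewrite exprSr -!mulrA; congr (_ * _); rewrite mulrC; congr (_ * _).
by apply: eq_bigr => j neqj; rewrite mnmDE mnm1E eq_sym (negPf neqj) addn0.
Qed.

Lemma ffact_atDU a b i :
  ffact_at a (b + U_(i))%MM = ffact_at a b * ((a i)%:R - (b i)%:R).
Proof.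
have stepE : (a i ^_ (b i).+1)%:R = (a i ^_ b i)%:R * ((a i)%:R - (b i)%:R) :> K.
  rewrite ffactnSr natrM; case: (leqP (b i) (a i)) => [leba|ltab].
    by rewrite natrB.
  by rewrite ffact_small // !mul0r.
rewrite /ffact_at (bigD1 i) //= [in RHS](bigD1 i) //= mnmDE mnm1E eqxx addn1.
rewrite natrM [in RHS]natrM stepE mulrAC; congr (_ * _%:R * _).
by apply: eq_bigr => j neqj; rewrite mnmDE mnm1E eq_sym (negPf neqj) addn0.
Qed.

Lemma moment_exchange b c i :
  moment b (c + U_(i))%MM = moment (b + U_(i))%MM c - (c i)%:R * moment b c.
Proof.
rewrite /moment mulr_sumr -sumrB; apply: eq_bigr => a _.
rewrite power_atDU ffact_atDU [(c i)%:R * _]mulrCA -mulrBr; congr (_ * _).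
rewrite !mulrBr -!mulrA; congr (_ - _); first by rewrite [_%:R * _]mulrC.
by rewrite [(c i)%:R * _]mulrC -mulrA.
Qed.

(** Monomials and products of falling factorials of degree < m span the same
    polynomials. *)
Lemma ffact_moments_eq0 (m : nat) :
  (forall b, (mdeg b < m)%N -> moment 0%MM b = 0) <->
  (forall b, (mdeg b < m)%N -> moment b 0%MM = 0).
Proof.
split=> M0.
  have: forall e b c, mdeg b = e -> (mdeg b + mdeg c < m)%N -> moment b c = 0.
    elim=> [|e IHe] b c.
      by move/eqP; rewrite mdeg_eq0 => /eqP->; rewrite mdeg0 => /M0.
    case/mnm_peel => i [b' [-> degb']]; rewrite mdegD mdeg1 addn1 addSn => ltm.
    rewrite -[LHS](subrK ((c i)%:R * moment b' c)) -moment_exchange.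
    by rewrite !IHe ?mulr0 ?addr0 ?mdegD ?mdeg1 ?addn1 ?addnS // ltnW.
  by move=> h b ltb; apply: (h _ _ _ erefl); rewrite mdeg0 addn0.
have: forall e b c, mdeg c = e -> (mdeg b + mdeg c < m)%N -> moment b c = 0.
  elim=> [|e IHe] b c.
    by move/eqP; rewrite mdeg_eq0 => /eqP->; rewrite mdeg0 addn0 => /M0.
  case/mnm_peel => i [c' [-> degc']]; rewrite mdegD mdeg1 addn1 addnS => ltm.
  by rewrite moment_exchange !IHe ?mulr0 ?subr0 ?mdegD ?mdeg1 ?addn1 ?addSn // ltnW.
by move=> h b ltb; apply: (h _ _ _ erefl); rewrite mdeg0.
Qed.

(** On E the form x_0 + ... + x_n takes the constant value d, which is
    invertible in K: multiplying a monomial by it raises the degree by one while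
    scaling the values on E by d. *)
Lemma top_moments_eq0 (d m : nat) : d%:R != 0 :> K ->
  (forall a, a \in E -> mdeg a = d) ->
  (forall b, mdeg b = m -> moment b 0%MM = 0) ->
  forall b, (mdeg b <= m)%N -> moment b 0%MM = 0.
Proof.
move=> nzd degE M0 b lebm; have [e dist] : exists e, (m - mdeg b)%N = e by eexists.
elim: e b lebm dist => [|e IHe] b lebm.
  by move/eqP; rewrite subn_eq0 => lemb; apply: M0; apply/eqP; rewrite eqn_leq lebm.
move=> dist; have ltbm : (mdeg b < m)%N by rewrite -subn_gt0 dist.
apply: (mulfI nzd).
have -> : d%:R * moment b 0%MM = \sum_i moment (b + U_(i))%MM 0%MM.
  rewrite /moment exchange_big mulr_sumr; apply: eq_big_seq => a /degE <-.
  under [RHS]eq_bigr => i _ do rewrite power_atDU mulrAC mulrA.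
  by rewrite -mulr_sumr -natr_sum -mdegE mulrC.
rewrite mulr0 big1 // => i _; apply: IHe; rewrite mdegD mdeg1 addn1 //.
by rewrite subnS dist.
Qed.

End Moments.

Section Torus.
Variables (K : fieldType) (iota : {rmorphism rat -> K}).
Variables (n d m : nat) (E : {fset 'X_{1..n.+1}}).
Hypothesis (degE : forall a, a \in E -> mdeg a = d) (nzd : d%:R != 0 :> K).

Lemma vanishing_moments (p : 'rV[K]_n.+1) (c : 'X_{1..n.+1} -> K) :
  in_torus p ->
  vanishes_with_mult (\sum_(a <- E) c a *: 'X_[a]) p m <->
  (forall b, (mdeg b < m)%N ->
     moment E (fun a => c a * 'X_[a].@[p 0]) 0%MM b = 0).
Proof.
move=> nzp; pose x b := 'X_[b].@[p 0].
have nzx b : x b != 0 by exact: torus_monomial_neq0.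
have key b : (\sum_(a <- E) c a *: 'X_[a])^`M[b].@[p 0] * x b
    = moment E (fun a => c a * x a) 0%MM b.
  rewrite !raddf_sum /= mulr_suml; apply: eq_bigr => a _.
  rewrite mderivmZ mderivmX !mevalZ /power_at.
  rewrite [X in X * ffact_at _ _ _]big1 => [|i _]; last by rewrite mnm0E.
  rewrite mul1r -!mulrA; congr (_ * _); rewrite [RHS]mulrC /ffact_at.
  (* If b <= a fails, X^(a - b) is truncated, but the coefficient is 0. *)
  have [leba|] := boolP (b <= a)%MM.
    by rewrite /x -mevalM -mpolyXD submK.
  rewrite negb_forall => /existsP[i nle].
  by rewrite (bigD1 i) //= ffact_small ?mul0n ?mul0r // ltnNge.
split=> h b /h; rewrite -key; first by move=> ->; rewrite mul0r.
by move/eqP; rewrite mulf_eq0 (negPf (nzx b)) orbF => /eqP.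
Qed.

Lemma meval_mpoint (g : {mpoly rat[n.+1]}) a :
  iota (g.@[mpoint a 0]) = \sum_(b <- msupp g) iota g@_b * power_at K a b.
Proof.
rewrite mevalE rmorph_sum; apply: eq_bigr => b _; rewrite rmorphM rmorph_prod.
congr (_ * _); apply: eq_bigr => i _.
by rewrite mxE rmorphXn rmorph_nat.
Qed.

(** Multiplicity m at a torus point is a linear condition on the weights
    c_a p^a whose equations have rational coefficients and are the same for all
    p: the values on E of rational forms of degree m - 1. *)
Lemma vanishing_forms (p : 'rV[K]_n.+1) (c : 'X_{1..n.+1} -> K) :
  in_torus p -> (0 < m)%N ->
  vanishes_with_mult (\sum_(a <- E) c a *: 'X_[a]) p m <->
  (forall g : {mpoly rat[n.+1]}, g \is m.-1.-homog ->
     \sum_(a <- E) c a * 'X_[a].@[p 0] * iota g.@[mpoint a 0] = 0).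
Proof.
move=> nzp m_gt0; apply: iff_trans (vanishing_moments c nzp) _.
apply: iff_trans (ffact_moments_eq0 _ _ _) _.
have momE gamma b : moment E gamma b 0%MM = \sum_(a <- E) gamma a * power_at K a b.
  apply: eq_bigr => a _; rewrite /ffact_at big1 ?mulr1 // => i _.
  by rewrite mnm0E ffactn0.
split=> [M0 g /dhomogP homg | G0 b].
  under eq_bigr => a _ do rewrite meval_mpoint mulr_sumr.
  rewrite exchange_big big_seq big1 // => b /homg degb.
  under eq_bigr => a _ do rewrite mulrCA.
  rewrite -mulr_sumr -momE M0 ?mulr0 //.
  by rewrite -(prednK m_gt0) ltnS -degb.
rewrite -(prednK m_gt0) ltnS; apply: (top_moments_eq0 nzd degE) => {}b degb.
rewrite momE -[RHS](G0 'X_[b]) ?dhomogX; last exact/eqP.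
apply: eq_bigr => a _; rewrite meval_mpoint msuppX big_seq1 mcoeffX eqxx.
by rewrite rmorph1 mul1r.
Qed.

End Torus.

(** * Peeling off parallel hyperplanes *)

(** The common direction L lies in the hyperplane of coordinate sum 0, so a
    point x of coordinate sum d > 0 in H_l is outside L, and H_l = L + <x> is determined by x. *)
Lemma parallel_hyperplanes_disjoint (n d k : nat) (d_gt0 : (0 < d)%N)
    (H : 'I_k -> {vspace 'rV[rat]_n.+1}) :
  injective H -> (forall i, \dim (H i) = n) ->
  meet_Dtilde_in_parallel_hyperplanes d H ->
  forall i j x, Dtilde d x -> x \in H i -> x \in H j -> i = j.
Proof.
move=> H_inj dimH [L [dimL HL]] i j x Dx xi xj; apply: H_inj.
suff spanE l : x \in H l -> H l = (L + <[x]>)%VS by rewrite (spanE i xi) (spanE j xj).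
move=> xl; have [b [[bl Db] bL]] := HL l.
have LH y : y \in L -> y \in H l /\ \sum_i y 0 i = 0.
  move=> yL; have [ybl Dyb] : b + y \in H l /\ Dtilde d (b + y).
    by apply/bL; rewrite addrAC subrr add0r.
  split; first by rewrite -(addKr b y) rpredD // rpredN.
  move: Dyb Db; rewrite /Dtilde; under eq_bigr => s _ do rewrite mxE.
  by rewrite big_split /= => + eb; rewrite eb -[RHS]addr0 => /addrI.
apply/esym/eqP; rewrite eqEdim; apply/andP; split.
  apply/subvP => _ /memv_addP[y /LH[yl _] [_ /vlineP[c ->] ->]].
  by rewrite rpredD // rpredZ.
rewrite dimH dimv_disjoint_sum; last first.
  apply/eqP; rewrite -subv0; apply/subvP => y.
  case/memv_capP => /LH[_ sum_y] /vlineP[c yE].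
  move: sum_y; rewrite memv0 yE; under eq_bigr => s _ do rewrite mxE.
  rewrite -mulr_sumr Dx => /eqP.
  rewrite mulf_eq0 Num.Theory.pnatr_eq0 (gtn_eqF d_gt0) orbF.
  by move/eqP ->; rewrite scale0r.
rewrite dim_vline -[X in (X <= _)%N]dimL -addn1 leq_add2l lt0b; apply/eqP => x0.
move: Dx; rewrite /Dtilde x0 big1 => [/esym/eqP|s _]; last by rewrite mxE.
by rewrite Num.Theory.pnatr_eq0 (gtn_eqF d_gt0).
Qed.

(** The values on the zero loci of ell_0, ..., ell_(l-1) being right, those
    on the zero locus of ell_l are corrected by adding a multiple of
    Q = ell_0 ... ell_(l-1); Q does not vanish there because the loci do not
    meet on E. *)
Lemma interpolation_by_peeling (n m k : nat) (E : {fset 'X_{1..n.+1}})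
    (ell : 'I_k -> {mpoly rat[n.+1]}) :
  (k <= m)%N -> (forall i, ell i \is 1.-homog) ->
  (forall a, a \in E -> exists i, (ell i).@[mpoint a 0] = 0) ->
  (forall a i j, a \in E -> (ell i).@[mpoint a 0] = 0 ->
     (ell j).@[mpoint a 0] = 0 -> i = j) ->
  (forall (i : 'I_k) h, exists2 g, g \is (m - i.+1).-homog &
     forall a, a \in E -> (ell i).@[mpoint a 0] = 0 -> g.@[mpoint a 0] = h a) ->
  forall h, exists2 g, g \is m.-1.-homog &
    forall a, a \in E -> g.@[mpoint a 0] = h a.
Proof.
move=> lekm homl E_cover E_disj interp h.
suff main l : (l <= k)%N -> exists2 g, g \is m.-1.-homog &
    forall a (i : 'I_k),
    a \in E -> (i < l)%N -> (ell i).@[mpoint a 0] = 0 -> g.@[mpoint a 0] = h a.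
  have [g homg gh] := main k (leqnn k).
  by exists g => // a aE; have [i ai] := E_cover a aE; apply: (gh a i).
elim: l => [|l IHl] ltlk.
  by exists 0; [exact: rpred0 | move=> ? ?; rewrite ltn0].
have [g homg gh] := IHl (ltnW ltlk).
pose i0 := Ordinal ltlk; pose Q := \prod_(i < k | (i < l)%N) ell i.
have [g1 homg1 g1h] :=
  interp i0 (fun a => (h a - g.@[mpoint a 0]) / Q.@[mpoint a 0]).
have homQ : Q \is l.-homog.
  have -> : l = (\sum_(i < k | (i < l)%N) 1)%N.
    by rewrite (big_ord_narrow (ltnW ltlk)) sum1_card card_ord.
  by apply: (@dhomog_big_prod _ _ _ _ _ (fun=> 1%N)) => i _; exact: homl.
exists (g + Q * g1).
  rewrite rpredD // (_ : m.-1 = (l + (m - l.+1))%N) ?dhomogM //.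
  by rewrite -[in LHS](subnKC (leq_trans ltlk lekm)) addSn.
move=> a i aE; rewrite ltnS leq_eqVlt mevalD mevalM => /orP[/eqP il|ltil] ai.
  have ii0 : i = i0 by apply: val_inj.
  rewrite g1h -?ii0 // mulrC divfK; first by rewrite addrC subrK.
  rewrite rmorph_prod; apply/prodf_neq0 => j ltjl; apply/eqP => aj.
  by move: ltjl; rewrite (E_disj a j i aE aj ai) il ltnn.
rewrite (gh a i) //; suff -> : Q.@[mpoint a 0] = 0 by rewrite mul0r addr0.
by rewrite rmorph_prod (bigD1 i) //= ai mul0r.
Qed.

(** * Criteria for special and non-special triples *)

Section Criteria.
Variables (K : fieldType) (charK0 : [pchar K] =i pred0).
Variables (n d m : nat) (d_gt0 : (0 < d)%N) (m_gt0 : (0 < m)%N).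
Variables (E : {fset 'X_{1..n.+1}}) (degE : forall a, a \in E -> mdeg a = d).
Hypothesis cardE : (#|` E| <= 'C(m + n - 1, n))%N.

Let nzd : d%:R != 0 :> K.
Proof.
have natr_eq0 : forall i : nat, (i%:R == 0 :> K) = (i == 0)%N by apply/pcharf0P.
by rewrite natr_eq0 -lt0n.
Qed.

(** Weights gamma killing all forms of degree m - 1 kill in particular a form
    equal to 1 at a and to 0 on the rest of E, whence gamma_a = 0. *)
Lemma nonspecial_if_interpolation :
  (forall h : 'X_{1..n.+1} -> rat, exists2 g : {mpoly rat[n.+1]},
     g \is m.-1.-homog & forall a, a \in E -> g.@[mpoint a 0] = h a) ->
  nonspecial K E m.
Proof.
move=> interp; have [iota] := rat_embedding charK0.
(* [cardE] says that the truncated expected dimension is 0. *)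
rewrite /nonspecial (eqP cardE).
exists (@in_torus K n); split; first exact: torus_open.
  by exists (const_mx 1) => i; rewrite mxE oner_neq0.
move=> p nzp; exists (fun=> 0); split=> [c _ []//|f]; split; last first.
  case=> c ->; rewrite big_ord0; split; last by move=> b _; rewrite raddf0 meval0.
  by exists (fun=> 0); rewrite big1 // => a _; rewrite scale0r.
case=> [[c ->]] /(vanishing_forms iota degE nzd c nzp m_gt0) c_forms.
exists (fun=> 0); rewrite big_ord0 big_seq big1 // => a aE.
have [g homg gE] := interp (fun b => (b == a)%:R).
have := c_forms g homg.
rewrite (bigD1_seq a) ?fset_uniq //= gE // eqxx rmorph1 mulr1.
rewrite big_seq_cond big1 => [|b /andP[bE neqba]]; last first.
  by rewrite gE // (negPf neqba) rmorph0 mulr0.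
rewrite addr0 => /eqP; rewrite mulf_eq0 => /orP[/eqP->|]; first by rewrite scale0r.
by rewrite (negPf (torus_monomial_neq0 a nzp)).
Qed.

(** Dividing gamma_a by p^a turns a dependency into a nonzero polynomial of
    V_E(m) at any torus point p, and every nonempty open set contains one. *)
Lemma special_if_dependency (F : {fset 'X_{1..n.+1}})
    (gamma : 'X_{1..n.+1} -> rat) :
  (F `<=` E)%fset -> (exists2 a, a \in F & gamma a != 0) ->
  (forall g : {mpoly rat[n.+1]}, g \is m.-1.-homog ->
     \sum_(a <- F) gamma a * g.@[mpoint a 0] = 0) ->
  special K E m.
Proof.
move=> sFE [a0 a0F nz_a0] gamma_forms [U [openU exU dimU]].
have [iota] := rat_embedding charK0.
have [p Up nzp] := open_meets_torus charK0 openU exU.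
have nzX a : 'X_[a].@[p 0] != 0 by exact: torus_monomial_neq0.
pose c a := if a \in F then iota (gamma a) / 'X_[a].@[p 0] else 0.
have f_VE : VE_at E m p (\sum_(a <- E) c a *: 'X_[a]).
  split; first by exists c.
  apply/(vanishing_forms iota degE nzd c nzp m_gt0) => g homg.
  rewrite -(big_fset_incl _ sFE) => [|a _ aF]; last first.
    by rewrite /c (negPf aF) !mul0r.
  rewrite -[RHS](rmorph0 iota) -(gamma_forms g homg) rmorph_sum.
  by apply: eq_big_seq => a aF; rewrite /c aF divfK // rmorphM.
have := dimU p Up; rewrite (eqP cardE) => -[b [_ /(_ _)/[dup] spanb _]].
have [e f0] := (spanb _).1 f_VE.
have /(congr1 (fun f => f@_a0)) := f0; rewrite big_ord0 mcoeff0 raddf_sum /=.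
rewrite (bigD1_seq a0) ?fset_uniq ?(fsubsetP sFE) //=.
rewrite big1 => [|a neq]; last by rewrite mcoeffZ mcoeffX (negPf neq) mulr0.
rewrite mcoeffZ mcoeffX eqxx mulr1 addr0 /c a0F => /eqP.
rewrite mulf_eq0 invr_eq0 (negPf (nzX a0)) orbF -(rmorph0 iota).
by move/eqP/fmorph_inj/eqP; rewrite (negPf nz_a0).
Qed.

End Criteria.

(** * Triples supported on parallel hyperplanes *)

Lemma sum_bin_diagonal (n m k : nat) : (0 < n)%N -> (k <= m)%N ->
  (\sum_(i < k) 'C(m - i.+1 + n - 1, n - 1) + 'C(m - k + n - 1, n)
     = 'C(m + n - 1, n))%N.
Proof.
case: n => // n _; elim: k => [|k IHk] lekm; first by rewrite big_ord0 subn0.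
rewrite big_ord_recr -(IHk (ltnW lekm)) /= -addnA; congr (_ + _)%N.
by rewrite subn1 -(subnSK lekm) !addnS !subn1 /= addSn binS addnC.
Qed.

Theorem lemma4p10 (K : fieldType) (charK0 : [pchar K] =i pred0)
    (n d m : nat) (n_ge1 : (1 <= n)%N) (d_ge1 : (1 <= d)%N) (m_ge1 : (1 <= m)%N)
    (E : {fset 'X_{1..n.+1}}) (E_sub_Dd : forall a, a \in E -> mdeg a = d)
    (cardE : (#|` E| <= 'C(m + n - 1, n))%N)
    (k : nat) (k_ge1 : (1 <= k)%N) (k_le_m : (k <= m)%N)
    (H : 'I_k -> {vspace 'rV[rat]_n.+1}) (H_inj : injective H)
    (dimH : forall i, \dim (H i) = n)
    (H_par : meet_Dtilde_in_parallel_hyperplanes d H) :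
  let EH (i : 'I_k) := [fset a in E | mpoint a \in H i]%fset in
  let E' := [fset a in E | [exists i, mpoint a \in H i]]%fset in
  (* the index i : 'I_k stands for i.+1 in the range 1..k *)
  [/\ (\sum_(i < k) 'C(m - i.+1 + n - 1, n - 1) =
         'C(m + n - 1, n) - 'C(m - k + n - 1, n))%N,
      (\sum_(i < k) 'C(m - i.+1 + n - 1, n - 1) < #|` E'|)%N ->
        special K E m
    & E = E' ->
      (forall i : 'I_k, (#|` EH i| <= 'C(m - i.+1 + n - 1, n - 1))%N) ->
      (forall i : 'I_k,
          has_dim (WS (S := H i) (m - i.+1) (EH i))
            ('C(m - i.+1 + n - 1, n - 1) - #|` EH i|)%N) ->
      nonspecial K E m].
Proof.
move=> EH E'.
have [ell ell_neq0 ellP] : exists2 ell : 'I_k -> {mpoly rat[n.+1]},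
    (forall i, ell i \is 1.-homog /\ ell i != 0) &
    forall i (x : 'rV_n.+1), (x \in H i) = ((ell i).@[x 0] == 0).
  have /fin_all_exists[c cP] (i : 'I_k) : exists c : 'cV[rat]_n.+1,
      c != 0 /\ forall u, (u \in H i) = (u *m c == 0).
    by have [|c nzc cP] := hyperplane_equation (U := H i); [rewrite dimH | exists c].
  exists (fun i => linear_form (c i)) => [i|i x].
    by split; [exact: linear_form_homog | exact: linear_form_neq0 (cP i).1].
  rewrite (cP i).2 meval_linear_form; apply/eqP/eqP => [->|h]; first by rewrite mxE.
  by apply/matrixP => r s; rewrite !ord1 h mxE.
have sumE := sum_bin_diagonal n_ge1 k_le_m.
split; first by rewrite -sumE addnK.
- move=> ltE'; pose L := \prod_i ell i.
  have LE' a : a \in E' -> L.@[mpoint a 0] = 0.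
    rewrite !inE => /andP[_ /existsP[i]]; rewrite ellP => /eqP ai.
    by rewrite rmorph_prod (bigD1 i) //= ai mul0r.
  have homL : L \is k.-homog.
    have := @dhomog_big_prod rat n.+1 'I_k (index_enum 'I_k) predT (fun=> 1%N) ell.
    by rewrite sum1_card card_ord; apply=> i _; case: (ell_neq0 i).
  have nzL : L != 0 by apply/prodf_neq0 => i _; case: (ell_neq0 i).
  have [|gamma [gamma_neq0 gamma_forms]] :=
      dependency_on_zero_locus (D := m.-1) nzL homL LE'.
    have top : 'C(m.-1 + n, m.-1) = 'C(m + n - 1, n).
      by rewrite -{3}(prednK m_ge1) addSn subn1 /= -[RHS]bin_sub ?leq_addl // addnK.
    (* For k = m no nonzero form of degree m - 1 is a multiple of L, and
        'C(n - 1, n) = 0. *)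
    have low : (if (k <= m.-1)%N then 'C(m.-1 - k + n, m.-1 - k) else 0%N)
        = 'C(m - k + n - 1, n).
      case: leqP => [lek|ltk].
        rewrite -{3}(prednK m_ge1) subSn // addSn subn1 /=.
        by rewrite -[RHS]bin_sub ?leq_addl // addnK.
      rewrite bin_small // (_ : m - k = 0)%N; first by rewrite add0n subn1 prednK.
      by apply/eqP; rewrite subn_eq0 -(prednK m_ge1).
    by rewrite top low -sumE ltn_add2r.
  have sE'E : (E' `<=` E)%fset by apply: fset_sub.
  exact: (special_if_dependency charK0 d_ge1 m_ge1 E_sub_Dd cardE sE'E
            gamma_neq0 gamma_forms).
move=> EE' leEH dimW.
apply: (nonspecial_if_interpolation charK0 d_ge1 m_ge1 E_sub_Dd cardE).
apply: (interpolation_by_peeling (ell := ell) k_le_m).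
- by move=> i; case: (ell_neq0 i).
- move=> a; rewrite EE' !inE => /andP[_ /existsP[i]].
  by rewrite ellP => /eqP; exists i.
- move=> a i j aE /eqP ai /eqP aj.
  apply: (parallel_hyperplanes_disjoint d_ge1 H_inj dimH H_par (x := mpoint a)).
  + rewrite /Dtilde -(E_sub_Dd a aE) mdegE natr_sum.
    by apply: eq_bigr => s _; rewrite mxE.
  + by rewrite ellP.
  + by rewrite ellP.
- move=> i h; have EH_H a : a \in EH i -> mpoint a \in H i.
    by rewrite !inE => /andP[].
  have [g homg gE] :=
    interpolation_on_subspace n_ge1 (dimH i) EH_H (leEH i) (dimW i) h.
  exists g => // a aE ai; apply: gE.
  by rewrite !inE aE ellP ai eqxx.
Qed.
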